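(* Let $d\ge 2$, let $\mathcal{G}\subseteq\mathcal{G}_d$ be a class of finite connected simple $d$-regular graphs, let $T=(\mathcal{L}_{in},\mathcal{S}_{in},\mathcal{L}_{out},\mathcal{S}_{out})=(\mathcal{I}_d,\mathcal{O}_d,\Delta)$ be an LCL task for $\mathcal{G}$, and let $t\ge 0$ be an integer. Then the following two statements hold. 1. If there exists a distributed algorithm solving $T$ in $t$ rounds in the LOCAL model then, for every integer $R\ge N(d,t+1)$, there is a name-preserving name-independent simplicial map $\delta:\mathcal{P}^{(t)}_{d,[R]}\to\mathcal{O}_d$ such that, for every facet $F\in\mathcal{I}_{d,[R]}$, $\delta(\Xi_t(F))\subseteq\Delta(\pi(F))$. 2. There exists an integer $R\ge N(d,t+1)$ satisfying that, if there is a name-preserving name-independent simplicial map $\delta:\mathcal{P}^{(t)}_{d,[R]}\to\mathcal{O}_d$ such that, for every facet $F\in\mathcal{I}_{d,[R]}$, $\delta(\Xi_t(F))\subseteq\Delta(\pi(F))$, then there is a distributed algorithm solving $T$ in $t$ rounds in the LOCAL model.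
   Context: **Graphs and stars.** For $d\ge 2$, $\mathcal{G}_d$ is the class of finite connected simple undirected $d$-regular graphs. $[R]=\{1,\dots,R\}$. The star $S_d$ is the $(d+1)$-node graph with center named $p_0$ and leaves named $p_1,\dots,p_d$ (each leaf adjacent to the center, no other edges). A star in a graph $G\in\mathcal{G}_d$ consists of a node (the center) and its $d$ neighbors (the leaves). For a finite set $\mathcal{L}$, a star labeled by $\mathcal{L}$ is $S_d$ with a label of $\mathcal{L}$ on each node, and labeled stars are considered up to isomorphism (i.e. up to permuting the leaves). **LCL tasks.** An LCL task for $\mathcal{G}\subseteq\mathcal{G}_d$ is a quadruple $T=(\mathcal{L}_{in},\mathcal{S}_{in},\mathcal{L}_{out},\mathcal{S}_{out})$ with $\mathcal{L}_{in},\mathcal{L}_{out}$ finite sets of labels, $\mathcal{S}_{in}$ a set of stars labeled by $\mathcal{L}_{in}$ and $\mathcal{S}_{out}$ a set of stars labeled by $\mathcal{L}_{out}$ (the ''good'' stars). A legal input on $G=(V,E)\in\mathcal{G}$ is a labeling $V\to\mathcal{L}_{in}$ such that every labeled star of $G$ is isomorphic to a star in $\mathcal{S}_{in}$. An output labeling $V\to\mathcal{L}_{out}$ is correct if every labeled star of $G$ is isomorphic to a star in $\mathcal{S}_{out}$. **Views and LOCAL algorithms.** An ID assignment on $G$ gives the nodes pairwise distinct positive integers. Given $G\in\mathcal{G}$ with a legal input and an ID assignment, the view of node $v$ after $t$ rounds is the ball of radius $t$ centered at $v$ (the nodes at distance at most $t$ from $v$, and the edges having an endpoint at distance at most $t-1$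 from $v$; for $t=0$ just $v$), with $v$ marked as center, together with the IDs and input labels of all nodes in the ball. A $t$-round distributed algorithm in the LOCAL model is a function $\mathrm{alg}$ from views after $t$ rounds to $\mathcal{L}_{out}$, each node $v$ outputting the image of its view. It solves $T$ in $t$ rounds if, for every $G\in\mathcal{G}$, every legal input on $G$ and every ID assignment on $G$, the resulting output labeling is correct. **Number $N(d,t)$.** $N(d,t)=1+d+d(d-1)+\dots+d(d-1)^{t-1}$, i.e. $N(d,t)=1+2t$ if $d=2$ and $N(d,t)=1+d\,\frac{(d-1)^t-1}{d-2}$ otherwise. **Complexes.** A simplicial complex is a collection of non-empty subsets (simplices) of a finite vertex set, closed under taking non-empty subsets. A facet is a maximal simplex. A complex is determined by its facets, and its vertices are those belonging to its facets. A simplicial map is a map on vertices sending simplices to simplices. * The input complex $\mathcal{I}_d$ (resp. output complex $\mathcal{O}_d$) has as facets the sets $\{(p_i,x_i): i\in\{0,\dots,d\}\}$ with all $x_i\in\mathcal{L}_{in}$ (resp. $\mathcal{L}_{out}$) such that the labeled star obtained by assigning $x_i$ to node $p_i$ of $S_d$, for all $i$, is in $\mathcal{S}_{in}$ (resp. $\mathcal{S}_{out}$). * $\Delta:\mathcal{I}_d\to 2^{\mathcal{O}_d}$ is defined by $\Delta(F)=\{\text{all facets of }\mathcal{O}_d\}$ for every facet $F$ of $\mathcal{I}_d$. * For a finite set $X$ of IDs, $\mathcal{I}_{d,X}$ is $\mathcal{I}_d$ extended with IDs in $X$: its facets are the sets $\{(p_i,(\mathrm{id}_i,x_i)): i\in\{0,\dots,d\}\}$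 where $\{(p_i,x_i): 0\le i\le d\}$ is a facet of $\mathcal{I}_d$ and $\mathrm{id}_0,\dots,\mathrm{id}_d\in X$ are pairwise distinct. The simplicial map $\pi:\mathcal{I}_{d,X}\to\mathcal{I}_d$ is $\pi(p_i,(\mathrm{id},x))=(p_i,x)$. * An ordered collection $w_0,\dots,w_d$ of views after $t$ rounds is mutually compatible for $\mathcal{G}$ if there exist a graph $G\in\mathcal{G}$, a legal input on $G$, an ID assignment on $G$, and a star in $G$ with center $v_0$ and leaves $v_1,\dots,v_d$ such that $w_i$ is the view of $v_i$ after $t$ rounds, for $i=0,\dots,d$. * The $t$-round protocol complex $\mathcal{P}^{(t)}_{d,X}$ has as facets the sets $\{(p_i,w_i): i\in\{0,\dots,d\}\}$ where $w_0,\dots,w_d$ is an ordered collection of mutually compatible views after $t$ rounds for $\mathcal{G}$ in which all IDs appearing in the views belong to $X$ (the IDs of nodes of $G$ appearing in none of these views are unrestricted, apart from distinctness). * For a facet $F=\{(p_i,(\mathrm{id}_i,x_i)): 0\le i\le d\}$ of $\mathcal{I}_{d,X}$, $\Xi_t(F)$ is the set of facets $\{(p_i,w_i): 0\le i\le d\}$ of $\mathcal{P}^{(t)}_{d,X}$ such that, for each $i$, the center of $w_i$ has ID $\mathrm{id}_i$ and input label $x_i$. The condition $\delta(\Xi_t(F))\subseteq\Delta(\pi(F))$ means $\delta(F')\in\Delta(\pi(F))$ for every $F'\in\Xi_t(F)$. **Name-preserving, name-independent.** A map $\delta:\mathcal{P}^{(t)}_{d,X}\to\mathcal{O}_d$ is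 name-preserving if every vertex $(p_i,w)$ is mapped to a vertex of the form $(p_i,y)$. It is name-independent if moreover $y$ depends only on $w$, i.e. whenever $(p_i,w)$ and $(p_j,w)$ are both vertices, $\delta(p_i,w)=(p_i,y)$ and $\delta(p_j,w)=(p_j,y)$ for the same $y$. *)

(* Defs.v *)
From HB Require Import structures.
From mathcomp Require Import all_boot all_order all_fingroup finmap.
From mathcomp Require Import all_classical.
Set Implicit Arguments.
Unset Strict Implicit.
Unset Printing Implicit Defensive.

Local Open Scope classical_set_scope.
Local Open Scope nat_scope.

(** * Graphs and stars *)

Record regular_graph (d : nat) := RegularGraph {
  node :> finType;
  adj : rel node;
  adj_sym : symmetric adj;
  adj_irr : irreflexive adj;
  adj_regular : forall v, #|[set u | adj v u]%SET| = d;
  adj_connected : forall u v, connect adj u v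
}.

Definition walk d (G : regular_graph d) (u v : G) (k : nat) : bool :=
  [exists p : k.-tuple G, path (@adj d G) u p && (last u p == v)].

Lemma walk_exists d (G : regular_graph d) (u v : G) : exists k, walk u v k.
Proof.
have /connectP[p up vp] := adj_connected u v.
by exists (size p); apply/existsP; exists (in_tuple p); rewrite /= up vp eqxx.
Qed.

Definition dist d (G : regular_graph d) (u v : G) : nat :=
  ex_minn (walk_exists u v).

Lemma dist_refl d (G : regular_graph d) (v : G) : dist v v = 0.
Proof.
rewrite /dist; case: ex_minnP => m _ /(_ 0) H; apply/eqP; rewrite -leqn0 H //.
by apply/existsP; exists [tuple]; rewrite /= eqxx.
Qed.

(* The star with center [v ord0] and leaves [v i], [i != ord0], listed in some
   order; index [i] plays the role of the node name p_i. *)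
Definition is_star d (G : regular_graph d) (v : 'I_d.+1 -> G) : Prop :=
  injective v /\
  [set v i | i in predC1 ord0]%SET = [set u | adj (v ord0) u]%SET.

(* A star labeled by L gives the label of each node p_i of S_d; isomorphisms
   permute the leaves. *)
Definition star_iso d (L : Type) (x y : 'I_d.+1 -> L) : Prop :=
  exists s : {perm 'I_d.+1}, s ord0 = ord0 /\ forall i, x i = y (s i).

(* Membership in a set of labeled stars considered up to isomorphism: S may
   contain any nonempty selection of representatives of each of its classes. *)
Definition good_star d (L : finType) (S : {set {ffun 'I_d.+1 -> L}})
    (x : 'I_d.+1 -> L) : Prop :=
  exists2 y : {ffun 'I_d.+1 -> L}, y \in S & star_iso x y.

Definition good_labeling d (L : finType) (S : {set {ffun 'I_d.+1 -> L}})
    (G : regular_graph d) (x : G -> L) : Prop :=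
  forall v : 'I_d.+1 -> G, is_star v -> good_star S (x \o v).

(** * LCL tasks *)

Record lcl (d : nat) := LCL {
  Lin : finType;
  Sin : {set {ffun 'I_d.+1 -> Lin}};
  Lout : finType;
  Sout : {set {ffun 'I_d.+1 -> Lout}}
}.

Record instance d (C : regular_graph d -> Prop) (T : lcl d) := Instance {
  graph_of :> regular_graph d;
  graph_in_class : C graph_of;
  input : graph_of -> Lin T;
  input_legal : good_labeling (Sin T) input;
  id_of : graph_of -> nat;
  id_pos : forall v, 0 < id_of v;
  id_inj : injective id_of
}.

(** * Views and algorithms *)

(* IDs being pairwise distinct, a node of a view is represented by its ID
   together with its input label; thus two views that are isomorphic as
   labeled graphs with IDs are equal. *)
Record view (L : choiceType) := View {
  center : nat * L;
  nodes : {fset nat * L};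
  edges : {fset {fset nat * L}}
}.

Definition ids_of (L : choiceType) (w : view L) : {fset nat} :=
  [fset p.1 | p in nodes w]%fset.

Definition view_of d (C : regular_graph d -> Prop) (T : lcl d) (t : nat)
    (I : instance C T) (v : I) : view (Lin T) :=
  let tag (u : I) := (id_of u, input u) in
  View (tag v)
    [fset tag u | u : I & dist v u <= t]%fset
    [fset [fset tag e.1; tag e.2]
       | e : I * I & adj e.1 e.2 && (dist v e.1 < t)]%fset.

Definition views d (C : regular_graph d -> Prop) (T : lcl d) (t : nat) :
    set (view (Lin T)) :=
  [set w | exists (I : instance C T) (v : I), w = view_of t v].

Arguments views [d] C T t.

Lemma view_of_in d (C : regular_graph d -> Prop) (T : lcl d) t
    (I : instance C T) (v : I) : view_of t v \in views C T t.
Proof. by apply/mem_set; exists I, v. Qed.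

(* Only views that occur for a graph of the class, a legal input and an ID
   assignment are in the domain: with an empty set of output labels, a task
   without instances is solvable. *)
Definition algorithm d (C : regular_graph d -> Prop) (T : lcl d) (t : nat) :=
  views C T t -> Lout T.

Arguments algorithm [d] C T t.

Definition output d (C : regular_graph d -> Prop) (T : lcl d) t
    (alg : algorithm C T t) (I : instance C T) (v : I) : Lout T :=
  alg (exist _ (view_of t v) (view_of_in t v)).

Definition solves d (C : regular_graph d -> Prop) (T : lcl d) t
    (alg : algorithm C T t) : Prop :=
  forall I : instance C T, good_labeling (Sout T) (@output d C T t alg I).

Definition Nball (d t : nat) : nat := 1 + \sum_(k < t) d * (d - 1) ^ k.

(** * Simplicial complexes *)

Record complex (V : Type) := Complex {
  simplex : set (set V);
  simplex_nonempty : forall s, simplex s -> s !=set0;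
  simplex_closed : forall s s',
    simplex s -> s' `<=` s -> s' !=set0 -> simplex s';
  simplex_finite : finite_set (\bigcup_(s in simplex) s)
}.

Definition vertices V (K : complex V) : set V := \bigcup_(s in simplex K) s.

Definition facet V (K : complex V) (F : set V) : Prop :=
  simplex K F /\ forall s, simplex K s -> F `<=` s -> s = F.

(* Maps are defined on the vertices of K only (there may be none), [set_val] being the inclusion of
   [vertices K] in V. *)
Definition image_of V W (K : complex V) (f : vertices K -> W) (s : set V) :
    set W :=
  f @` (set_val @^-1` s).

Definition simplicial V W (K : complex V) (K' : complex W)
    (f : vertices K -> W) : Prop :=
  forall s, simplex K s -> simplex K' (image_of f s).

(* The set {(p_i, a_i) : 0 <= i <= d}. *)
Definition named d (A : Type) (a : 'I_d.+1 -> A) : set ('I_d.+1 * A) :=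
  [set (i, a i) | i in [set: 'I_d.+1]].

Section NamedComplex.
Variables (d : nat) (A : Type) (P : set ('I_d.+1 -> A)) (B : set A).
Hypotheses (finB : finite_set B) (PB : forall a, P a -> forall i, B (a i)).

Let sx : set (set ('I_d.+1 * A)) :=
  [set s | s !=set0 /\ exists2 a, P a & s `<=` named a].

Fact named_complex_nonempty s : sx s -> s !=set0. Proof. by case. Qed.

Fact named_complex_closed s s' : sx s -> s' `<=` s -> s' !=set0 -> sx s'.
Proof.
move=> [_ [a Pa sa]] ss' s'0; split=> //; exists a => //.
exact: subset_trans sa.
Qed.

Fact named_complex_finite : finite_set (\bigcup_(s in sx) s).
Proof.
apply: (@sub_finite_set _ _ ([set: 'I_d.+1] `*` B)); last first.
  by apply: finite_setX => //; exact: finite_finset.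
by move=> p [s [_ [a Pa sa]] /sa[i _ <-]]; split=> //=; exact: PB.
Qed.

(* The complex with facets the sets [named a], [P a]. *)
Definition named_complex : complex ('I_d.+1 * A) :=
  Complex named_complex_nonempty named_complex_closed named_complex_finite.

Lemma named_inj (a b : 'I_d.+1 -> A) : named a `<=` named b -> a = b.
Proof.
move=> ab; apply/funext => i.
by have [|j _ [-> ->]] // := ab (i, a i); exists i.
Qed.

Lemma facet_named_complexE F :
  facet named_complex F <-> exists2 a, P a & F = named a.
Proof.
have sxP a : P a -> sx (named a).
  by move=> Pa; split; [exists (ord0, a ord0), ord0 | exists a].
split=> [[[F0 [a Pa Fa]] maxF]|[a Pa ->]].
  by exists a => //; rewrite (maxF (named a))//; exact: sxP.
split=> [|s [_ [b Pb sb]] a_s]; first exact: sxP.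
apply/seteqP; split=> //.
by have -> : a = b by apply: named_inj => p /a_s/sb.
Qed.

End NamedComplex.

(* Finiteness of the vertex set does not depend on P, hence on S. *)
Definition label_complex d (L : finType) (S : {set {ffun 'I_d.+1 -> L}}) :
    complex ('I_d.+1 * L) :=
  named_complex (P := [set x | good_star S x])
    (@finite_finset L [set: L]) (fun _ _ _ => I).

Definition input_complex d (T : lcl d) := label_complex (Sin T).
Definition output_complex d (T : lcl d) := label_complex (Sout T).

Definition Delta d (T : lcl d) (F : set ('I_d.+1 * Lin T)) :
    set (set ('I_d.+1 * Lout T)) :=
  [set H | facet (output_complex T) H].

Definition id_inputs d (T : lcl d) (X : {fset nat}) :
    set ('I_d.+1 -> nat * Lin T) :=
  [set a | facet (input_complex T) (named (snd \o a)) /\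
     (forall i, (a i).1 \in X) /\ injective (fst \o a)].

Arguments id_inputs [d] T X.

Fact id_inputs_finite (L : finType) (X : {fset nat}) :
  finite_set ([set` X] `*` [set: L]).
Proof. exact: finite_setX (finite_fset X) finite_finset. Qed.

Fact id_inputs_sub d (T : lcl d) (X : {fset nat}) a :
  id_inputs T X a -> forall i, ([set` X] `*` [set: Lin T]) (a i).
Proof. by move=> [_ [aX _]] i; split=> //=. Qed.

Definition id_input_complex d (T : lcl d) (X : {fset nat}) :
    complex ('I_d.+1 * (nat * Lin T)) :=
  named_complex (id_inputs_finite (Lin T) X) (@id_inputs_sub d T X).

Definition forget_id d (T : lcl d) (p : 'I_d.+1 * (nat * Lin T)) :
    'I_d.+1 * Lin T :=
  (p.1, p.2.2).

Definition mutually_compatible d (C : regular_graph d -> Prop) (T : lcl d)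
    (t : nat) (w : 'I_d.+1 -> view (Lin T)) : Prop :=
  exists (I : instance C T) (v : 'I_d.+1 -> I),
    is_star v /\ forall i, w i = view_of t (v i).

Definition protocol_views d (C : regular_graph d -> Prop) (T : lcl d)
    (t : nat) (X : {fset nat}) : set ('I_d.+1 -> view (Lin T)) :=
  [set w | mutually_compatible C t w /\ forall i, (ids_of (w i) `<=` X)%fset].

(* The views all of whose nodes are in N: the only use of this set is to bound
   the vertex set of the protocol complex. *)
Definition views_within (L : choiceType) (N : {fset nat * L}) : set (view L) :=
  [set w | [/\ center w \in N, (nodes w `<=` N)%fset &
               (edges w `<=` fpowerset N)%fset]].

Fact views_within_finite (L : choiceType) (N : {fset nat * L}) :
  finite_set (views_within N).
Proof.
pose f p := View (L := L) p.1 p.2.1 p.2.2.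
apply: (@sub_finite_set _ _ (f @` ([set` N] `*` ([set` fpowerset N] `*`
                                   [set` fpowerset (fpowerset N)])))).
  case=> c n e [/= cN nN eN]; exists (c, (n, e)) => //.
  by split=> //=; split=> /=; rewrite fpowersetE.
apply: finite_image; apply: finite_setX; first exact: finite_fset.
by apply: finite_setX; exact: finite_fset.
Qed.

Arguments protocol_views [d] C T t X.

Fact protocol_views_sub d (C : regular_graph d -> Prop) (T : lcl d) t
    (X : {fset nat}) w :
  protocol_views C T t X w ->
  forall i, views_within (X `*` [fset y in enum (Lin T)])%fset (w i).
Proof.
move=> [[I [v [_ wv]]] wX] i; move/(_ i): wX; rewrite {}wv.
move/fsubsetP => wX.
have tagN (u : I) : dist (v i) u <= t ->
    (id_of u, input u) \in (X `*` [fset y in enum (Lin T)])%fset.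
  move=> ut; rewrite in_fsetM /= !inE mem_enum andbT.
  apply: wX; apply/imfsetP; exists (id_of u, input u) => //=.
  by apply/imfsetP; exists u.
have step (a b : I) : adj a b -> dist (v i) a < t -> dist (v i) b <= t.
  rewrite /dist; case: ex_minnP => m /existsP[p /andP[pp /eqP pa]] _ ab mt.
  case: ex_minnP => n _ /(_ m.+1) nm; apply: leq_trans mt; apply: nm.
  apply/existsP; exists [tuple of rcons p b].
  by rewrite /= rcons_path pp pa ab last_rcons eqxx.
split=> /=.
- by apply: tagN; rewrite dist_refl.
- by apply/fsubsetP => _ /imfsetP[u /= ut ->]; apply: tagN; move: ut; rewrite inE.
- apply/fsubsetP => _ /imfsetP[[a b] /= ab ->].
  move: ab; rewrite inE /= => /andP[ab at_].
  rewrite fpowersetE; apply/fsubsetP => p /fset2P[] ->.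
    exact/tagN/ltnW.
  exact/tagN/(step a).
Qed.

Definition protocol_complex d (C : regular_graph d -> Prop) (T : lcl d)
    (t : nat) (X : {fset nat}) : complex ('I_d.+1 * view (Lin T)) :=
  named_complex (views_within_finite _) (@protocol_views_sub d C T t X).

Definition Xi d (C : regular_graph d -> Prop) (T : lcl d) (t : nat)
    (X : {fset nat}) (F : set ('I_d.+1 * (nat * Lin T))) :
    set (set ('I_d.+1 * view (Lin T))) :=
  [set F' | facet (protocol_complex C T t X) F' /\
     exists a w, [/\ F = named a, F' = named w &
                     forall i, center (w i) = a i]].

Definition name_preserving d (A B : Type) (K : complex ('I_d.+1 * A))
    (f : vertices K -> 'I_d.+1 * B) : Prop :=
  forall p : vertices K, (f p).1 = (set_val p).1.

Definition name_independent d (A B : Type) (K : complex ('I_d.+1 * A))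
    (f : vertices K -> 'I_d.+1 * B) : Prop :=
  forall p q : vertices K,
    (set_val p).2 = (set_val q).2 -> (f p).2 = (f q).2.

Definition id_range (R : nat) : {fset nat} := [fset i in iota 1 R]%fset.

Definition solving_map d (C : regular_graph d -> Prop) (T : lcl d) (t R : nat)
    (delta : vertices (protocol_complex C T t (id_range R)) ->
             'I_d.+1 * Lout T) : Prop :=
  [/\ simplicial (output_complex T) delta,
      name_preserving delta,
      name_independent delta &
      forall F, facet (id_input_complex T (id_range R)) F ->
        image_of delta @` Xi C t (id_range R) F `<=`
          Delta (@forget_id d T @` F)].

(* Main.v *)
Require Import Defs.
From mathcomp Require Import all_boot finmap all_classical.

(** An algorithm is a map on views, and by name-independence so is a solving
map; the only gap is that the IDs of the latter lie in [R].  It is bridged by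
making the solving map order-invariant: the values of delta on the views with
N = (d+1)^(t+1) IDs at most colour the N-subsets of [R], and Ramsey's theorem
yields a set X of 2N IDs whose N-subsets all have the same colour, so that on
views with IDs among the first N elements of X (the last N serve as padding)
delta depends on the relative order of the IDs only.  The algorithm replaces the
IDs of its view, in order, by the first elements of X and applies delta.  The
views of the nodes of a star involve only the ball of radius t+1 around its
center, which has at most N nodes: replacing the IDs of this ball, in order, by
elements of X, and the other IDs by integers above R, gives an instance whose
views are in the protocol complex and on which delta agrees with the algorithm. *)

Set Implicit Arguments.
Unset Strict Implicit.
Unset Printing Implicit Defensive.

Local Open Scope nat_scope.

(** * Ramsey's theorem and finite colourings *)

Lemma pigeonhole (T : Type) (K : finType) (c : T -> K) (M : nat) (s : seq T) :
  #|K| * M < size s -> exists k, M < count (fun x => c x == k) s.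
Proof.
move=> lt_s; apply/existsP; apply: contraLR lt_s.
rewrite negb_exists => /forallP count_le; rewrite -leqNgt.
have -> : size s = \sum_k count (fun x => c x == k) s.
  elim: s {count_le} => [|x s IHs] /=; first by rewrite big1.
  rewrite big_split /= -IHs (bigD1 (c x))//= eqxx big1// => k.
  by rewrite eq_sym => /negbTE->.
rewrite -sum_nat_const; apply: leq_sum => k _.
by rewrite leqNgt; exact: count_le.
Qed.

(** Finite sets are encoded as subsequences. By induction on [k], the colour is made to depend on
    the first element only; pigeonhole then keeps elements of one colour. [R] is fixed before [f],
    because the colouring to which this is applied comes from a map on a complex that depends on
    [R]. *)
Lemma ramsey (K : finType) (k M : nat) : exists R : nat,
  forall (T : eqType) (f : seq T -> K) (s : seq T), R <= size s ->
  exists X c, [/\ subseq X s, size X = M &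
                  forall y, subseq y X -> size y = k -> f y = c].
Proof.
elim: k M => [|k IHk] M.
  exists M => T f s Ms; exists (take M s), (f [::]); split.
  - exact: take_subseq.
  - by rewrite size_takel.
  - by move=> y _ /size0nil ->.
(* A large subsequence on which the colour of [x :: y] depends on [x] only. *)
have prehomogeneous n : exists R : nat,
    forall (T : eqType) (f : seq T -> K) (s : seq T), R <= size s ->
    exists X (c : T -> K), [/\ subseq X s, size X = n &
      forall x y, subseq (x :: y) X -> size y = k -> f (x :: y) = c x].
  elim: n => [|n [R HR]].
    by exists 1 => T f [|x s]// _; exists [::], (fun x => f [:: x]).
  (* Once the head [x] is removed, [R'] yields a subsequence of size [R] on which the colour of
     [x :: y] is constant; the induction on [n] goes on inside it. *)
  have [R' HR'] := IHk R; exists R'.+1 => T f [|x s]//= Rs.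
  have [X0 [c0 [X0s sX0 fX0]]] := HR' T (fun y => f (x :: y)) s Rs.
  have [|X [c [XX0 sX fX]]] := HR T f X0; first by rewrite sX0.
  exists (x :: X), (fun z => if z == x then c0 else c z); split.
  - by rewrite /= eqxx (subseq_trans XX0).
  - by rewrite /= sX.
  - move=> z y /=; case: eqP => [->|_]; last exact: fX.
    by move=> yX; apply: fX0; exact: subseq_trans XX0.
(* With more than [#|K| * M] elements, some colour is taken more than [M] times. *)
have [R HR] := prehomogeneous (#|K| * M).+1; exists R => T f s Rs.
have [X [c [Xs sX fX]]] := HR T f s Rs.
have [|k0 Mk] := @pigeonhole _ _ c M X; first by rewrite sX.
set Y := [seq x <- X | c x == k0].
have YX : subseq (take M Y) X.
  exact: subseq_trans (take_subseq _ _) (filter_subseq _ _).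
exists (take M Y), k0; split; first exact: subseq_trans Xs.
  by rewrite size_takel// size_filter ltnW.
case=> [|x y]// yY [sy]; rewrite (fX x y) ?(subseq_trans yY)//.
have /mem_subseq/(_ x) := yY.
by rewrite mem_head => /(_ isT)/mem_take; rewrite mem_filter => /andP[/eqP].
Qed.

(** The colour is the tuple of values along an enumeration of [S], so that one Ramsey colour records
    a whole map on [S]. *)
Lemma finite_coloring (V : Type) (S : set V) (Z : finType) :
  finite_set S -> exists (K : finType) (col : (V -> Z) -> K),
    forall g g', col g = col g' -> forall x, S x -> g x = g' x.
Proof.
move=> /(@finite_seqP {classic V})[s ->].
exists ((size s).-tuple Z : finType), (fun g => map_tuple g (in_tuple s)).
move=> g g' /(congr1 val)/= eq_gg' x xs.
by have /(_ x xs) := proj2 (@eq_in_map {classic V} Z g g' s) eq_gg'.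
Qed.

(** * Increasing sequences of integers *)

Lemma ltn_sorted_subseq (s1 s2 : seq nat) :
  sorted ltn s1 -> sorted ltn s2 -> {subset s1 <= s2} -> subseq s1 s2.
Proof.
move=> s1_sorted s2_sorted s12.
have -> : s1 = [seq x <- s2 | x \in s1]; last exact: filter_subseq.
apply: (irr_sorted_eq ltn_trans ltnn) => //.
  exact: sorted_filter ltn_trans _ _ s2_sorted.
by move=> x; rewrite mem_filter andb_idr//; exact: s12.
Qed.

Lemma ltn_sorted_sort (s : seq nat) : uniq s -> sorted ltn (sort leq s).
Proof.
by move=> us; rewrite ltn_sorted_uniq_leq sort_uniq us (sort_sorted leq_total).
Qed.

(** * Distances, balls and stars *)

Section Distance.
Variables (d : nat) (G : regular_graph d).
Implicit Types u v a b : G.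

Lemma dist_leP v u n :
  reflect (exists p, [/\ path (@adj d G) v p, last v p = u & size p <= n])
          (dist v u <= n).
Proof.
rewrite /dist; case: ex_minnP => m walk_m minm.
apply: (iffP idP) => [mn|[q [vq qu qn]]].
  by case/existsP: walk_m => p /andP[vp /eqP pu]; exists p; rewrite size_tuple.
apply: leq_trans qn; apply: minm; apply/existsP; exists (in_tuple q).
by rewrite /= vq qu eqxx.
Qed.

Lemma dist_adjr v a b n : adj a b -> dist v a <= n -> dist v b <= n.+1.
Proof.
move=> ab /dist_leP[p [vp pa pn]]; apply/dist_leP; exists (rcons p b).
by rewrite rcons_path vp pa ab last_rcons size_rcons.
Qed.

Lemma dist_adjl v a b n : adj v a -> dist a b <= n -> dist v b <= n.+1.
Proof.
move=> va /dist_leP[p [ap pb pn]]; apply/dist_leP; exists (a :: p).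
by rewrite /= va.
Qed.

(** Closed neighborhoods of the nodes at distance at most [n] cover the next ball, and each has at
    most [d.+1] nodes. What matters is that the bound does not depend on the graph. *)
Lemma card_ball v n : #|[set u | dist v u <= n]%SET| <= d.+1 ^ n.
Proof.
elim: n => [|n IHn].
  rewrite expn0 -(cards1 v); apply/subset_leq_card/fintype.subsetP => u.
  by rewrite !inE => /dist_leP[[|x p] [//= _ <-]].
set B := [set u | _]%SET in IHn *.
pose N a := (a |: [set u | adj a u])%SET.
have cardN a : #|N a| <= d.+1 by rewrite cardsU1 adj_regular inE adj_irr.
apply: (@leq_trans #|finset.cover (N @: B)%SET|).
  apply/subset_leq_card/fintype.subsetP => u; rewrite inE => /dist_leP[p].
  case/lastP: p => [|p x] [vp pu pn].
    apply/bigcupP; exists (N v); last by rewrite -pu !inE eqxx.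
    by apply: imset_f; rewrite inE dist_refl.
  move: vp pu pn; rewrite rcons_path last_rcons size_rcons => /andP[vp px] <- pn.
  apply/bigcupP; exists (N (last v p)); last by rewrite !inE px orbT.
  by apply: imset_f; rewrite inE; apply/dist_leP; exists p.
apply: leq_trans (leq_card_cover _) _.
apply: (@leq_trans (\sum_(A in (N @: B)%SET) d.+1)).
  by apply: leq_sum => _ /imsetP[a _ ->].
rewrite sum_nat_const expnSr leq_mul2r (leq_trans (leq_imset_card _ _)) ?orbT//.
Qed.

Lemma star_at v : exists2 s : 'I_d.+1 -> G, s ord0 = v & is_star s.
Proof.
set A := [set u | adj v u]%SET.
have cardA : #|A| = d by exact: adj_regular.
pose leaf (j : 'I_d) := enum_val (cast_ord (esym cardA) j).
pose s (i : 'I_d.+1) := if unlift ord0 i is Some j then leaf j else v.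
have s0 : s ord0 = v by rewrite /s unlift_none.
have sl j : s (lift ord0 j) = leaf j by rewrite /s liftK.
have adj_leaf j : adj v (leaf j).
  by have := enum_valP (cast_ord (esym cardA) j); rewrite inE.
exists s => //; split.
  move=> i j; case: (unliftP ord0 i) => [i'|] ->;
    case: (unliftP ord0 j) => [j'|] ->; rewrite ?sl ?s0 //.
  - by move=> /enum_val_inj/cast_ord_inj ->.
  - by move=> vi; have := adj_leaf i'; rewrite vi adj_irr.
  - by move=> vj; have := adj_leaf j'; rewrite -vj adj_irr.
rewrite s0; apply/setP => u; rewrite inE; apply/imsetP/idP => [[i + ->]|vu].
  by case: (unliftP ord0 i) => [j|] ->; rewrite ?inE ?eqxx// sl adj_leaf.
have uA : u \in A by rewrite inE.
exists (lift ord0 (cast_ord cardA (enum_rank_in uA u))).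
  by rewrite inE eq_sym neq_lift.
by rewrite sl /leaf cast_ordK enum_rankK_in.
Qed.

(** Puts the views of all nodes of a star inside one ball around its center. *)
Lemma star_dist (s : 'I_d.+1 -> G) i u n :
  is_star s -> dist (s i) u <= n -> dist (s ord0) u <= n.+1.
Proof.
move=> [_ sE]; have [->|i0] := eqVneq i ord0; first exact: leqW.
apply: dist_adjl; have : s i \in [set s j | j in predC1 ord0]%SET.
  by apply: imset_f; rewrite inE.
by rewrite sE inE.
Qed.

End Distance.

(** * Renaming the IDs of a view *)

Section Relabel.
Variable L : choiceType.
Implicit Types (w : view L) (g h : nat -> nat).

Definition relabel_node g (p : nat * L) := (g p.1, p.2).

Definition relabel g w : view L :=
  View (relabel_node g (center w)) [fset relabel_node g p | p in nodes w]%fset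
    [fset [fset relabel_node g p | p in (e : {fset nat * L})]
       | e in edges w]%fset.

(** The first hypothesis excludes records whose center or edges involve pairs outside [nodes w], on
    which [g] and [h] could differ. *)
Lemma eq_relabel g h w : views_within (nodes w) w ->
  {in ids_of w, g =1 h} -> relabel g w = relabel h w.
Proof.
move=> [cw _ /fsubsetP ew] gh.
have ghN p : p \in nodes w -> relabel_node g p = relabel_node h p.
  by move=> pw; rewrite /relabel_node gh//; apply/imfsetP; exists p.
congr View; first exact: ghN.
  by apply: eq_in_imfset => // p; exact: ghN.
apply: eq_in_imfset => // e /ew; rewrite fpowersetE => /fsubsetP ew'.
by apply: eq_in_imfset => // p /ew'; exact: ghN.
Qed.

Lemma relabel_comp g h w : relabel g (relabel h w) = relabel (g \o h) w.
Proof.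
rewrite /relabel /=; congr View; rewrite -imfset_comp; first exact: eq_imfset.
apply: eq_imfset => // e /=.
by rewrite -imfset_comp.
Qed.

Lemma relabel_within (N : {fset nat * L}) g w : views_within (nodes w) w ->
  (forall p, p \in nodes w -> relabel_node g p \in N) ->
  views_within N (relabel g w).
Proof.
move=> [cw _ /fsubsetP ew] gN; split; first exact: gN.
  by apply/fsubsetP => _ /imfsetP[p /= pw ->]; exact: gN.
apply/fsubsetP => _ /imfsetP[e /= /ew ew' ->].
move: ew'; rewrite !fpowersetE => /fsubsetP ew'.
by apply/fsubsetP => _ /imfsetP[p /= /ew' pw ->]; exact: gN.
Qed.

Definition sorted_ids w : seq nat := sort leq (ids_of w).

Definition id_rank w (n : nat) : nat := index n (sorted_ids w).

(** The result depends on the IDs of [w] through their relative order only. *)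
Definition canonical (X : seq nat) w : view L := relabel (nth 0 X \o id_rank w) w.

End Relabel.

(** * Instances with new IDs *)

Section Instances.
Variables (d : nat) (C : regular_graph d -> Prop) (T : lcl d) (t : nat).

(** The graph is kept as it is, so that nodes of [I] are nodes of the new instance by conversion. *)
Definition with_ids (I : instance C T) (f : I -> nat) f_pos f_inj :
    instance C T :=
  @Instance d C T I (@graph_in_class _ _ _ I) _ (@input_legal _ _ _ I)
    f f_pos f_inj.

Lemma view_of_within (I : instance C T) (v : I) :
  views_within (nodes (view_of t v)) (view_of t v).
Proof.
have tagN (u : I) : dist v u <= t ->
    (id_of u, input u) \in nodes (view_of t v).
  by move=> ut; apply/imfsetP; exists u.
split=> //=; first by apply: tagN; rewrite dist_refl.
apply/fsubsetP => _ /imfsetP[[a b] /= + ->].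
rewrite inE /= => /andP[ab at_].
rewrite fpowersetE; apply/fsubsetP => p /fset2P[] ->.
  exact/tagN/ltnW.
exact/tagN/(leq_trans (dist_adjr ab (leqnn _))).
Qed.

Lemma ids_view_of (I : instance C T) (v : I) n :
  reflect (exists2 u : I, dist v u <= t & n = id_of u)
          (n \in ids_of (view_of t v)).
Proof.
apply: (iffP (imfsetP _ _ _ _)) => [[_ /imfsetP[u /= + ->] ->]|[u ut ->]].
  by rewrite inE => ut; exists u.
by exists (id_of u, input u) => //=; apply/imfsetP; exists u.
Qed.

Lemma view_of_with_ids (I : instance C T) f f_pos f_inj (v : I) g :
  (forall u, dist v u <= t -> f u = g (id_of u)) ->
  view_of t (v : @with_ids I f f_pos f_inj) = relabel g (view_of t v).
Proof.
move=> fg; congr View => /=.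
- by rewrite /relabel_node /= fg ?dist_refl.
- rewrite -imfset_comp; apply: eq_in_imfset => // u; rewrite inE => ut /=.
  by rewrite /relabel_node /= fg.
- rewrite -imfset_comp; apply: eq_in_imfset => // -[a b].
  rewrite inE /= => /andP[ab at_].
  have bt := leq_trans (dist_adjr ab (leqnn _)) at_.
  by rewrite imfset_fset2 /relabel_node /= (fg a (ltnW at_)) (fg b bt).
Qed.

(** By homogeneity, [F] does not see which [N] increasing entries of [X] replace the ranks in a
    view. Once the IDs around the star are moved into [X], each view is one such replacement and its
    canonical form is another. *)
Lemma star_canonical (Z : Type) (F : view (Lin T) -> Z) (R N : nat)
    (X : seq nat) (I : instance C T) (s : 'I_d.+1 -> I) :
  d.+1 ^ t.+1 <= N -> N + N <= size X -> subseq X (iota 1 R) ->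
  (forall A B, subseq A X -> subseq B X -> size A = N -> size B = N ->
     forall w, views_within ([fset n in iota 0 N] `*` [fset y in enum (Lin T)])%fset w ->
     F (relabel (nth 0 A) w) = F (relabel (nth 0 B) w)) ->
  is_star s ->
  exists2 w, protocol_views C T t (id_range R) w &
    forall i, F (w i) = F (canonical (take N X) (view_of t (s i))).
Proof.
move=> ltN sizeX XR hom s_star.
have uniqX : uniq X by rewrite (subseq_uniq XR)// iota_uniq.
pose B u := dist (s ord0) u <= t.+1.
pose LB := sort leq [seq id_of u | u : I in B].
have LBP u : (id_of u \in LB) = B u.
  by rewrite mem_sort fintype.mem_image//; exact: id_inj.
have sortedLB : sorted ltn LB.
  by apply: ltn_sorted_sort; rewrite map_inj_uniq ?enum_uniq//; exact: id_inj.
have sizeLB : size LB <= N.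
  rewrite size_sort size_map -cardE.
  apply: leq_trans ltN; apply: leq_trans (card_ball (s ord0) t.+1).
  by apply/subset_leq_card/fintype.subsetP => u; rewrite !inE.
have leNX : N <= size X by apply: leq_trans sizeX; exact: leq_addr.
have rank_lt n : n \in LB -> index n LB < size X.
  by rewrite -index_mem => /leq_trans; apply; exact: leq_trans leNX.
pose h n := nth 0 X (index n LB).
have hX n : n \in LB -> h n \in iota 1 R.
  by move=> nLB; apply: (mem_subseq XR); rewrite mem_nth ?rank_lt.
(* Near IDs land in [R] and far ones above [R], so the two cases cannot collide. *)
pose f u := if B u then h (id_of u) else R + id_of u.
have f_far u : B u = false -> R < f u.
  by rewrite /f => ->; rewrite -addn1 leq_add2l id_pos.
have f_near u : B u -> 0 < f u <= R.
  by move=> Bu; have := hX (id_of u); rewrite /f Bu mem_iota LBP; exact.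
have f_pos u : 0 < f u.
  case Bu: (B u); first by have /andP[] := f_near u Bu.
  by have := f_far u Bu; exact: leq_trans.
have f_inj : injective f.
  move=> u v fuv; case Bu: (B u); case Bv: (B v).
  - move: fuv; rewrite /f Bu Bv => /eqP; rewrite nth_uniq ?rank_lt ?LBP//.
    move=> /eqP /(congr1 (nth 0 LB)); rewrite !nth_index ?LBP//; exact: id_inj.
  - have := f_far v Bv; rewrite -fuv ltnNge.
    by have /andP[_ ->] := f_near u Bu.
  - have := f_far u Bu; rewrite fuv ltnNge.
    by have /andP[_ ->] := f_near v Bv.
  - by move: fuv; rewrite /f Bu Bv => /addnI; exact: id_inj.
pose J := with_ids f_pos f_inj.
have near_star i u : dist (s i) u <= t -> B u by exact: star_dist.
have viewJ i : view_of t (s i : J) = relabel h (view_of t (s i)).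
  by apply: view_of_with_ids => u /near_star Bu; rewrite /f Bu.
exists (fun i => view_of t (s i : J)).
  split; first by exists J, s.
  move=> i; apply/fsubsetP => n /ids_view_of[u /near_star Bu ->].
  rewrite /id_range !inE /= mem_iota add1n ltnS.
  exact: (f_near u Bu).
move=> i; rewrite viewJ /canonical.
set w := view_of t (s i); pose L := sorted_ids w.
have w_within := view_of_within (s i).
have memL n : (n \in L) = (n \in ids_of w) by rewrite mem_sort.
have sortedL : sorted ltn L by apply: ltn_sorted_sort; exact: fset_uniq.
(* An ID may have different ranks in [L] and in [LB], so [relabel h w] need not be the canonical
   view itself. *)
have L_LB : subseq L LB.
  apply: ltn_sorted_subseq => // n; rewrite memL => /ids_view_of[u ut ->].
  by rewrite LBP (near_star i).
have sizeL : size L <= N := leq_trans (size_subseq L_LB) sizeLB.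
(* [A] starts with the new IDs of [w]; the rest pads it to size [N]. *)
pose A := map h L ++ take (N - size L) (drop N X).
have hLB : map h LB = take (size LB) X.
  apply: (@eq_from_nth _ 0).
    by rewrite size_map size_takel// (leq_trans sizeLB).
  move=> k; rewrite size_map => kLB.
  rewrite (nth_map 0)// nth_take// /h index_uniq//.
  exact: sorted_uniq ltn_trans ltnn _ sortedLB.
(* The new IDs come from the first [N] entries of [X] and the padding from the later ones, so their
   concatenation respects the order of [X]. *)
have AX : subseq A X.
  rewrite -[X in subseq _ X](cat_take_drop N); apply: cat_subseq.
    apply: subseq_trans (map_subseq h L_LB) _; rewrite hLB.
    by rewrite -(subnKC sizeLB) takeD prefix_subseq.
  exact: take_subseq.
have sizeA : size A = N.
  rewrite size_cat size_map size_takel ?subnKC// size_drop.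
  by rewrite (leq_trans (leq_subr _ _))// leq_subRL.
(* Both views factor through the view labelled by ranks, whose IDs are below [N], as [hom]
   requires. *)
have -> : relabel h w = relabel (nth 0 A) (relabel (id_rank w) w).
  rewrite relabel_comp; apply: eq_relabel => // n; rewrite -memL => nL.
  rewrite /= /id_rank nth_cat size_map index_mem nL.
  by rewrite (nth_map 0) ?index_mem// nth_index.
rewrite -relabel_comp; apply: hom => //.
- exact: take_subseq.
- by rewrite size_takel.
apply: relabel_within => // p pw; rewrite in_fsetM !inE mem_enum andbT mem_iota.
rewrite /= add0n; apply: leq_trans sizeL; rewrite index_mem memL.
by apply/imfsetP; exists p.
Qed.

End Instances.

(** * Algorithms and maps on the protocol complex *)

Lemma good_star_ext d (L : finType) (S : {set {ffun 'I_d.+1 -> L}}) x y :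
  x =1 y -> good_star S x -> good_star S y.
Proof. by move=> /funext->. Qed.

Section Protocol.
Variables (d : nat) (C : regular_graph d -> Prop) (T : lcl d) (t : nat).

Lemma output_congr (alg : algorithm C T t) (I J : instance C T) (u : I) (v : J) :
  view_of t u = view_of t v -> output alg u = output alg v.
Proof. by move=> uv; congr alg; apply: val_inj. Qed.

Variable X : {fset nat}.
Local Notation K := (protocol_complex C T t X).

Lemma mem_vertices w i : protocol_views C T t X w -> (i, w i) \in vertices K.
Proof.
move=> Pw; apply/mem_set; exists (named w); last by exists i.
split; last by exists w.
by exists (i, w i); exists i.
Qed.

Definition vertex w i (Pw : protocol_views C T t X w) : vertices K :=
  exist _ (i, w i) (mem_vertices i Pw).

Lemma simplex_named w : protocol_views C T t X w -> simplex K (named w).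
Proof. by move=> Pw; split; [exists (ord0, w ord0); exists ord0|exists w]. Qed.

Lemma image_named (B : Type) (f : vertices K -> 'I_d.+1 * B) y w
    (Pw : protocol_views C T t X w) :
  (forall i, f (vertex i Pw) = (i, y i)) -> image_of f (named w) = named y.
Proof.
move=> fy; apply/seteqP; split=> [_ [p [i _ ip] <-]|_ [i _ <-]].
  by exists i => //; rewrite -fy; congr f; apply: val_inj.
by exists (vertex i Pw) => //=; exists i.
Qed.

(** The vertex (i, w) is sent to i and the output on w, which by [output_congr] is the same for all
    instances showing w. The star that makes the views of a facet compatible turns correctness into
    the facet condition. *)
Lemma algorithm_solving_map (alg : algorithm C T t) : solves alg ->
  exists delta : vertices K -> 'I_d.+1 * Lout T,
    [/\ simplicial (output_complex T) delta, name_preserving delta,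
      name_independent delta &
      forall F, facet (id_input_complex T X) F ->
        image_of delta @` Xi C t X F `<=` Delta (@forget_id d T @` F)]%classic.
Proof.
move=> alg_ok.
have /choice[delta deltaE] (p : vertices K) : exists y : 'I_d.+1 * Lout T,
    y.1 = (set_val p).1 /\
    forall (I : instance C T) (v : I), (set_val p).2 = view_of t v ->
      y.2 = output alg v.
  have [s [_ [w [[J [v [_ wv]]] _] sw]] ps] := set_valP p.
  have [i _ ip] := sw _ ps.
  exists (i, output alg (v i)); split=> [|I u]; first by rewrite -[set_val p]ip.
  by rewrite -[set_val p]ip /= wv => /output_congr.
have delta_named w : protocol_views C T t X w ->
    exists2 y, good_star (Sout T) y & image_of delta (named w) = named y.
  move=> Pw; have [[I [v [v_star wv]]] _] := Pw.
  exists (@output _ _ _ _ alg I \o v); first exact: alg_ok.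
  apply: (image_named (Pw := Pw)) => i; have [d1 d2] := deltaE (vertex i Pw).
  by rewrite [LHS]surjective_pairing d1 (d2 I (v i) (wv i)).
exists delta; split.
- move=> s [[p sp] [w Pw sw]]; have [y Sy yE] := delta_named w Pw.
  split; last first.
    by exists y => //; rewrite -yE; apply: image_subset; exact: preimage_subset.
  have pK : p \in vertices K.
    by apply/mem_set; exists (named w); [exact: simplex_named|exact: sw].
  by exists (delta (exist _ p pK)), (exist _ p pK).
- by move=> p; have [] := deltaE p.
- move=> p q pq; have [_ d2] := deltaE q.
  have [s [_ [w [[J [v [_ wv]]] _] sw]] ps] := set_valP q.
  have [i _ iq] := sw _ ps.
  have qv : (set_val q).2 = view_of t (v i) by rewrite -[set_val q]iq -wv.
  rewrite (d2 _ _ qv); have [_ d2'] := deltaE p.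
  by apply: d2'; rewrite pq.
- move=> F _ _ [_ [/facet_named_complexE[w Pw ->] _] <-].
  have [y Sy ->] := delta_named w Pw.
  by apply/facet_named_complexE; exists y.
Qed.

(** The image of a facet is contained in [named y] for some good star [y], and preservation of names
    forces its vertex of name i to carry the label [y i]. *)
Lemma simplicial_good_star (delta : vertices K -> 'I_d.+1 * Lout T) w
    (Pw : protocol_views C T t X w) :
  simplicial (output_complex T) delta -> name_preserving delta ->
  good_star (Sout T) (fun i => (delta (vertex i Pw)).2).
Proof.
move=> delta_simp delta_name.
have [_ [y Sy ys]] := delta_simp _ (simplex_named Pw).
apply: good_star_ext Sy => i.
have [|j _ jE] := ys (delta (vertex i Pw)).
  by exists (vertex i Pw) => //=; exists i.
by rewrite -jE /=; congr y; have := delta_name (vertex i Pw); rewrite -jE.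
Qed.

End Protocol.

Theorem theorem6 (d : nat) (hd : 2 <= d) (C : regular_graph d -> Prop)
    (T : lcl d) (t : nat) :
  ((exists alg : algorithm C T t, solves alg) ->
   forall R : nat, Nball d t.+1 <= R ->
   exists delta : vertices (protocol_complex C T t (id_range R)) ->
                  'I_d.+1 * Lout T,
     solving_map delta) /\
  (exists R : nat, Nball d t.+1 <= R /\
     ((exists delta : vertices (protocol_complex C T t (id_range R)) ->
                      'I_d.+1 * Lout T,
         solving_map delta) ->
      exists alg : algorithm C T t, solves alg)).
Proof.
split=> [[alg alg_ok] R _|]; first exact: algorithm_solving_map alg_ok.
pose N := d.+1 ^ t.+1.
(* Views whose IDs are ranks, counted from 0: [relabel (nth 0 A)] turns them into views with IDs in
   [A]. *)
pose shapes :=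
  views_within ([fset n in iota 0 N] `*` [fset y in enum (Lin T)])%fset.
have finite_shapes : finite_set shapes by exact: views_within_finite.
(* The colour of a set of IDs records the outputs on all views carrying them. *)
have [K [col colP]] :=
  @finite_coloring _ _ (option (Lout T) : finType) finite_shapes.
have [R0 HR0] := ramsey K N (N + N).
exists (maxn (Nball d t.+1) R0); split; first exact: leq_maxl.
set R := maxn _ _; set P := protocol_complex C T t (id_range R).
move=> [delta [delta_simp delta_name delta_indep _]].
(* Name-independence lets [delta] descend to views; [None] is the value on views that are not in the
   complex. *)
have /choice[F FE] (w : view (Lin T)) : exists z : option (Lout T),
    forall p : vertices P, (set_val p).2 = w -> z = Some (delta p).2.
  have [[p pw]|no_p] := pselect (exists p : vertices P, (set_val p).2 = w).
    by exists (Some (delta p).2) => q qw; rewrite (delta_indep p q)// pw.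
  by exists None => p pw; case: no_p; exists p.
have [|X [c [XR sizeX Xc]]] :=
    HR0 _ (fun A => col (fun w => F (relabel (nth 0 A) w))) (iota 1 R).
  by rewrite size_iota leq_maxr.
have hom A B : subseq A X -> subseq B X -> size A = N -> size B = N ->
    forall w, shapes w -> F (relabel (nth 0 A) w) = F (relabel (nth 0 B) w).
  by move=> AX BX sA sB; apply: colP; rewrite !Xc.
pose canon (w : view (Lin T)) := F (canonical (take N X) w).
have starP (I : instance C T) (s : 'I_d.+1 -> I) : is_star s ->
    exists2 y, good_star (Sout T) y &
      forall i, canon (view_of t (s i)) = Some (y i).
  move=> s_star.
  have [|w Pw wE] := star_canonical (leqnn N) _ XR hom s_star.
    by rewrite sizeX.
  exists (fun i => (delta (vertex i Pw)).2).
    exact: simplicial_good_star.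
  by move=> i; rewrite /canon -wE; exact: FE.
(* A view that occurs is the view of the center of some star, so [starP] rules out [None]. *)
have /choice[alg algE] (w : views C T t) :
    exists y, canon (set_val w) = Some y.
  have [I [v wv]] := set_valP w; have [s sv s_star] := star_at v.
  have [y _ yE] := starP I s s_star; exists (y ord0).
  by rewrite -yE sv -wv.
exists alg => I s s_star; have [y Sy yE] := starP I s s_star.
apply: good_star_ext Sy => i; apply: Some_inj; rewrite -yE.
by rewrite /= /output; set w := exist _ _ _; exact: algE w.
Qed.
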